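(* For all $n\ge 4$, $\operatorname{ex}_{\Pi}(n,4,9)=2^{\operatorname{ex}(n,\{C_3,C_4\})}$.
   Context: For a set $X$, $\binom{X}{t}$ is the set of $t$-element subsets of $X$; $[n]=\{1,\dots,n\}$; $\mathbb{N}=\{0,1,2,\dots\}$. A multigraph is a pair $G=(V,w)$ where $V$ is a finite vertex set and $w:\binom{V}{2}\to\mathbb{N}$. $F(n,s,q)$ is the set of multigraphs $G=([n],w)$ such that $\sum_{xy\in\binom{X}{2}}w(xy)\le q$ for every $X\in\binom{[n]}{s}$. Let $P(G)=\prod_{xy\in\binom{V}{2}}w(xy)$ and $\operatorname{ex}_{\Pi}(n,s,q)=\max\{P(G):G\in F(n,s,q)\}$. $\operatorname{ex}(n,\{C_3,C_4\})$ is the maximum number of edges in a (simple) graph on $n$ vertices containing no $C_3$ or $C_4$ as a (not necessarily induced) subgraph. *)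

(* Defs.v *)
From mathcomp Require Import all_boot.

Set Implicit Arguments.
Unset Strict Implicit.
Unset Printing Implicit Defensive.

(* The vertex set [n] = {1, ..., n} is represented by 'I_n = {0, ..., n-1}. *)

Definition vpair (V : finType) := {e : {set V} | #|e| == 2}.

Definition multigraph (V : finType) := {ffun vpair V -> nat}.

Definition sq_graph (n s q : nat) (w : multigraph 'I_n) : Prop :=
  forall X : {set 'I_n}, #|X| = s ->
    \sum_(e : vpair 'I_n | val e \subset X) w e <= q.

Definition edge_product (V : finType) (w : multigraph V) : nat :=
  \prod_(e : vpair V) w e.

(* "ex_Pi(n, s, q) = m".  The set of (s, q)-graphs on 'I_n may be infinite
   (e.g. if n < s), so the maximum is a relation, which includes the fact that
   it is attained; m is unique when it exists. *)
Definition is_exPi (n s q m : nat) : Prop :=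
  (exists2 w : multigraph 'I_n, sq_graph s q w & edge_product w = m) /\
  (forall w : multigraph 'I_n, sq_graph s q w -> edge_product w <= m).

(* A simple graph on V is given by its set of edges. *)
Definition simple (V : finType) (E : {set {set V}}) : bool :=
  [forall e in E, #|e| == 2].

(* Copies are not necessarily induced: only the edges of H are constrained.
   The pattern H is assumed to be simple. *)
Definition contains (U V : finType) (H : {set {set U}}) (E : {set {set V}})
    : bool :=
  [exists f : {ffun U -> V}, injectiveb f && [forall e in H, f @: e \in E]].

Definition ograph := {k : nat & {set {set 'I_k}}}.

(* The cycle C_k, meaningful for k >= 3; ordS is the successor modulo k. *)
Definition cycle_graph (k : nat) : ograph :=
  existT (fun k => {set {set 'I_k}}) k [set [set i; ordS i] | i : 'I_k].

Definition ex (n : nat) (Hs : seq ograph) : nat :=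
  \max_(E : {set {set 'I_n}} |
          simple E && all (fun H : ograph => ~~ contains (projT2 H) E) Hs) #|E|.

(* Main.v *)
Require Import Defs.
From mathcomp Require Import all_boot.
From mathcomp Require Import zify.

(** Let [w] be a multigraph on at least four vertices in which every four
vertices span weight at most 9.  If some weight is 0 the product is 0.
Otherwise write [w = 1 + a].  Since [1 + a <= 2 ^ a], it is enough to bound the
total excess, the sum of [a] over all pairs, by the maximum number of edges of a
graph without triangles and 4-cycles; the hypothesis becomes that [a] has sum
at most 3 on every four vertices.

This additive bound is [sparse_bound], proved for every subset of at least four
vertices, by induction on its size [k].
- If some triple carries excess 3, no pair joining it to another vertex has
  positive excess, so deleting it costs exactly 3.
- If there is no such triple but some pair carries excess 2 or more, it carries
  exactly 2 and no pair meeting it in one vertex has positive excess, so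
  deleting it costs exactly 2.
- Otherwise [a] takes values in {0, 1}, and the pairs of excess 1 form a graph
  without triangles and 4-cycles.

In the first two cases what was lost is recovered by adding pendant edges, one
for each deleted vertex ([attainable_pendant]).  The induction hypothesis is
missing when fewer than four vertices are left.  Then [k] is 5 or 6, as the case
[k = 4] is immediate from the hypothesis, and the cycle with [k] edges is large
enough ([attainable_cycle]).

For the lower bound, give weight 2 to the edges of an extremal graph and weight
1 to the other pairs: without triangles and 4-cycles, four vertices span at most
three edges ([girth5_four_vertices]).

Sums over pairs are computed as sums over ordered pairs, which are twice as
large ([pair_sum]). *)

(** * Numbers of edges attained by graphs of girth at least five *)

(** [r] is the adjacency relation of a graph on the vertices [0, ..., n - 1]
without triangles and 4-cycles.  Irreflexivity makes adjacent vertices distinct,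
so only the diagonals of a 4-cycle need to be nondegenerate. *)
Definition girth5_on (n : nat) (r : rel nat) : Prop :=
  [/\ symmetric r, irreflexive r,
      forall x y, r x y -> x < n,
      forall x y z, ~~ [&& r x y, r y z & r z x]
    & forall x y z t, x != z -> y != t ->
        ~~ [&& r x y, r y z, r z t & r t x]].

(** Some graph on [n] vertices without triangles and 4-cycles has at least [d]
ordered pairs of adjacent vertices, that is, at least [d / 2] edges. *)
Definition attainable (n d : nat) : Prop :=
  exists2 r : rel nat, girth5_on n r & d <= \sum_(i < n) \sum_(j < n) r i j.

Lemma attainable_leq n d d' : d <= d' -> attainable n d' -> attainable n d.
Proof. by move=> le_d [r rP le_r]; exists r => //; apply: leq_trans le_r. Qed.

Lemma attainable1 : attainable 1 0.
Proof. by exists (fun _ _ => false) => //; split. Qed.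

(** The new vertex [n] is joined to the vertex [0]. *)
Lemma attainable_pendant n d :
  0 < n -> attainable n d -> attainable n.+1 d.+2.
Proof.
move=> n_gt0 [r [rS rI rB r3 r4] le_d].
have rB2 x y : r x y -> y < n by rewrite rS; apply: rB.
pose r' := [rel x y | [|| r x y, (x == 0) && (y == n) | (x == n) && (y == 0)]].
have isoL y : r n y = false by apply/negP => /rB; rewrite ltnn.
have isoR y : r y n = false by rewrite rS.
exists r'.
  split=> [x y|x|x y|x y z|x y z t]; rewrite /r' /=.
  - by rewrite rS; congr (_ || _); rewrite orbC; congr (_ || _); rewrite andbC.
  - by rewrite rI /=; lia.
  - by case/or3P=> [/rB|/andP[/eqP-> _]|/andP[/eqP-> _]]; lia.
  - apply/negP=> /and3P[].
    case: (eqVneq x n) => [->|xn]; case: (eqVneq y n) => [->|yn];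
    case: (eqVneq z n) => [->|zn];
    rewrite ?isoL ?isoR ?rI /= ?andbF ?andbT ?orbF /=; try lia.
    + by move=> /eqP-> h /eqP h'; move: h; rewrite h' rI.
    + by move=> /eqP-> /eqP->; rewrite rI.
    + by move=> h /eqP h1 /eqP h2; move: h; rewrite h1 h2 rI.
    + by move=> h1 h2 h3; have := r3 x y z; rewrite h1 h2 h3.
  - move=> xz yt; apply/negP=> /and4P[].
    case: (eqVneq x n) xz => [->|xn] xz; case: (eqVneq y n) yt => [->|yn] yt;
    case: (eqVneq z n) xz => [->|zn] xz; case: (eqVneq t n) yt => [->|tn] yt;
    rewrite ?isoL ?isoR ?rI /= ?andbF ?andbT ?orbF /=; try lia.
    by move=> h1 h2 h3 h4; have := r4 x y z t xz yt; rewrite h1 h2 h3 h4.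
have -> : \sum_(i < n.+1) \sum_(j < n.+1) r' i j =
          \sum_(i < n) \sum_(j < n) r i j + 2.
  have one (F : nat -> bool) : (forall i, i < n -> F i = (i == 0)) ->
      \sum_(i < n) F i = 1.
    move=> FE; rewrite (bigD1 (Ordinal n_gt0)) //= FE // big1 // => i.
    by rewrite -val_eqE /= FE // => /negPf->.
  have r'E i j : i < n -> j < n -> r' i j = r i j.
    by move=> i_n j_n; rewrite /r' /= (ltn_eqF i_n) (ltn_eqF j_n) andbF orbF.
  rewrite big_ord_recr /=.
  rewrite (eq_bigr (fun i : 'I_n => \sum_(j < n) r i j + r' i n)).
    rewrite big_split /= big_ord_recr /= (one (r' n)) ?(one (r'^~ n)).
    - by rewrite isoL; lia.
    - by move=> i _; rewrite /r' /= isoR; lia.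
    - by move=> i _; rewrite /r' /= isoL; lia.
  move=> i _; rewrite big_ord_recr /=; congr (_ + _).
  by apply: eq_bigr => j _; congr nat_of_bool; apply: r'E.
by rewrite addn2.
Qed.

Lemma attainable_cycle k : 5 <= k -> k <= 6 -> attainable k k.*2.
Proof.
move=> k5 k6.
pose r := [rel x y | [&& x < k, y < k & [|| y == x.+1, x == y.+1,
   (x == 0) && (y == k.-1) | (y == 0) && (x == k.-1)]]].
exists r.
  by split=> [x y|x|x y|x y z|x y z t]; rewrite /r /=; lia.
rewrite {}/r; have [->|->] : k = 5 \/ k = 6 by lia.
  by rewrite !big_ord_recr !big_ord0.
by rewrite !big_ord_recr !big_ord0.
Qed.

(** * The additive bound *)

(** The sum of [a] over the ordered pairs of elements of [s]. *)
Definition psum {T : eqType} (a : T -> T -> nat) (s : seq T) : nat :=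
  \sum_(x <- s) \sum_(y <- s) a x y.

Lemma perm_psum {T : eqType} (a : T -> T -> nat) (s t : seq T) :
  perm_eq s t -> psum a s = psum a t.
Proof.
move=> st; rewrite /psum (perm_big t) //=.
by apply: eq_bigr => x _; apply: perm_big.
Qed.

Lemma psum_cons {T : eqType} (a : T -> T -> nat) x (s : seq T) :
  (forall y z, a y z = a z y) -> (forall y, a y y = 0) ->
  psum a (x :: s) = (\sum_(y <- s) a x y).*2 + psum a s.
Proof.
move=> aS aI; rewrite /psum big_cons big_cons aI add0n.
under [X in _ + X = _]eq_bigr => y _ do rewrite big_cons.
rewrite big_split /= addnA; congr (_ + _); rewrite -addnn; congr (_ + _).
by apply: eq_bigr.
Qed.

Lemma perm_extract {T : eqType} (t s : seq T) :
  uniq t -> uniq s -> {subset t <= s} ->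
  exists2 s', perm_eq s (t ++ s') & uniq s' /\ forall x, x \in s' -> x \notin t.
Proof.
move=> ut us ts; exists [seq x <- s | x \notin t].
  rewrite -(perm_filterC (mem t) s) perm_cat2r uniq_perm ?filter_uniq // => x.
  by rewrite mem_filter /=; case: (boolP (x \in t)) => // /ts ->.
by split=> [|x]; [rewrite filter_uniq | rewrite mem_filter => /andP[]].
Qed.

(** The case of the main bound where [a] is the indicator of a graph. *)
Lemma attainable_sparse {T : eqType} (a : T -> T -> nat) (s : seq T) :
  (forall x y, a x y = a y x) -> (forall x, a x x = 0) ->
  {in s &, forall x y, a x y <= 1} ->
  {in s & &, forall x y z, uniq [:: x; y; z] ->
    a x y + a x z + a y z <= 2} ->
  (forall x y z t, uniq [:: x; y; z; t] ->
    a x y + a x z + a x t + a y z + a y t + a z t <= 3) ->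
  uniq s -> attainable (size s) (psum a s).
Proof.
move=> aS aI a1 a3 a4 us.
case: s => [|x0 s0] in us a1 a3 *.
  by exists (fun _ _ => false); [split | rewrite /psum big_nil].
set s := x0 :: s0 in us a1 a3 *; pose v := nth x0 s.
have neq p q : 0 < a (v p) (v q) -> p != q.
  by case: eqVneq => // ->; rewrite aI.
exists [rel i j | [&& i < size s, j < size s & 0 < a (v i) (v j)]].
  split=> [i j|i|i j|i j k|i j k l].
  - by rewrite /= (aS (v i)) andbCA.
  - by rewrite /= aI !andbF.
  - by case/and3P.
  - apply/negP=> /and3P[/and3P[i_s j_s ij] /and3P[_ k_s jk] /and3P[_ _ ki]].
    have := a3 _ _ _ (mem_nth x0 i_s) (mem_nth x0 j_s) (mem_nth x0 k_s).
    rewrite /= !inE !nth_uniq // !negb_or (neq _ _ ij) (neq _ _ jk).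
    rewrite [i == k]eq_sym (neq _ _ ki) -!/(v _) => /(_ isT).
    by move: ki; rewrite (aS (v k)); lia.
  move=> ik jl; apply/negP.
  case/and4P=> /and3P[i_s j_s ij] /and3P[_ k_s jk].
  move=> /and3P[_ l_s kl] /and3P[_ _ li].
  have := a4 (v i) (v j) (v k) (v l).
  rewrite /= !inE /v !nth_uniq // !negb_or (neq _ _ ij) (neq _ _ jk) (neq _ _ kl).
  rewrite [i == l]eq_sym (neq _ _ li) ik jl -!/(v _) => /(_ isT).
  by move: li; rewrite (aS (v l)); lia.
rewrite /psum (big_nth x0) big_mkord; apply: leq_sum => i _.
rewrite (big_nth x0) big_mkord; apply: leq_sum => j _.
rewrite /= (ltn_ord i) (ltn_ord j) /=.
have: a (v i) (v j) <= 1 by apply: a1; apply: mem_nth.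
by rewrite -/(v i) -/(v j); case: (a _ _) => [|[]].
Qed.

(** The hypothesis on triples follows from the one on quadruples as soon as the
whole vertex set has four elements. *)
Lemma sparse_bound {T : eqType} (a : T -> T -> nat) (s : seq T) :
  (forall x y, a x y = a y x) -> (forall x, a x x = 0) ->
  (forall x y z, uniq [:: x; y; z] -> a x y + a x z + a y z <= 3) ->
  (forall x y z t, uniq [:: x; y; z; t] ->
    a x y + a x z + a x t + a y z + a y t + a z t <= 3) ->
  uniq s -> 4 <= size s -> attainable (size s) (psum a s).
Proof.
move=> aS aI a3 a4.
have pS := psum_cons a _ _ aS aI.
have p0 : psum a [::] = 0 by rewrite /psum big_nil.
have [n] := ubnP (size s); elim: n s => // n IHn s /ltnSE s_n us s4.
have [s_4|s_gt4] := eqVneq (size s) 4.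
  (* A path with three edges suffices. *)
  rewrite s_4; apply: (@attainable_leq _ _ 6); last first.
    by do 3!apply: attainable_pendant => //; apply: attainable1.
  case: s s_4 us {s_n s4} => [|x [|y [|z [|t []]]]] // _ us.
  by have := a4 _ _ _ _ us; rewrite !pS p0 !big_cons !big_nil; lia.
pose heavy x y z := uniq [:: x; y; z] && (2 < a x y + a x z + a y z).
have [/hasP[x xs /hasP[y ys /hasP[z zs /andP[neq xyz]]]]|light] :=
  boolP (has (fun x => has (fun y => has (heavy x y) s) s) s).
  have xyz3 : a x y + a x z + a y z = 3.
    by have := a3 _ _ _ neq; lia.
  have sub : {subset [:: x; y; z] <= s}.
    by move=> t; rewrite !inE => /or3P[] /eqP->.
  have [s' ss' [us' s't]] := perm_extract _ _ neq us sub.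
  have nbr t : t \in s' -> [/\ a x t = 0, a y t = 0 & a z t = 0].
    move=> ts'; have xyzt : uniq (rcons [:: x; y; z] t) by rewrite rcons_uniq s't.
    by move: xyz3 (a4 _ _ _ _ xyzt); clear=> ? ?; split; lia.
  have sz := perm_size ss'; rewrite /= in sz.
  have sum0 u : u \in [:: x; y; z] -> \sum_(t <- s') a u t = 0.
    move=> uin; rewrite big_seq big1 // => t /nbr[? ? ?].
    by move: uin; rewrite !inE => /or3P[] /eqP->.
  have pE : psum a s = psum a s' + 6.
    rewrite (perm_psum a _ _ ss') /= !pS !big_cons !sum0 ?inE ?eqxx ?orbT //.
    lia.
  rewrite pE sz.
  have [s'4|s'4] := leqP 4 (size s').
    rewrite -[6]/(2 + 2 + 2) !addnA !addn2.
    do 3!(apply: attainable_pendant; first by lia).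
    by apply: IHn => //; lia.
  case: s' s'4 ss' us' s't nbr sz {sum0 pE}
    => [|u [|v [|t []]]] //= _ ss' us' s't nbr sz; try lia.
    (* The quadruples formed by u, v and two of x, y, z exclude a u v = 3, so
       the excess is at most 3 + 2. *)
    apply: (@attainable_leq _ _ 10); last exact: (attainable_cycle 5).
    have [? ? ?] := nbr u (mem_head _ _).
    have [? ? ?] : [/\ a x v = 0, a y v = 0 & a z v = 0].
      by apply: nbr; rewrite !inE eqxx orbT.
    rewrite !pS p0 !big_cons !big_nil.
    have us5 : uniq [:: x; y; z; u; v] by rewrite -(perm_uniq ss').
    have := a4 _ _ _ _ (mask_uniq us5 [:: true; true; false; true; true]).
    have := a4 _ _ _ _ (mask_uniq us5 [:: true; false; true; true; true]).
    have := a4 _ _ _ _ (mask_uniq us5 [:: false; true; true; true; true]).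
    lia.
  apply: (@attainable_leq _ _ 12); last exact: (attainable_cycle 6).
  by have := a3 _ _ _ us'; rewrite !pS p0 !big_cons !big_nil; lia.
have light3 : {in s & &, forall x y z, uniq [:: x; y; z] ->
    a x y + a x z + a y z <= 2}.
  move=> x y z xs ys zs xyz.
  move/hasPn/(_ x xs)/hasPn/(_ y ys)/hasPn/(_ z zs): light.
  by rewrite /heavy xyz -leqNgt.
have [/hasP[x xs /hasP[y ys axy]]|light2] :=
  boolP (has (fun x => has (fun y => 1 < a x y) s) s); last first.
  apply: attainable_sparse => // x y xs ys.
  by move/hasPn/(_ x xs)/hasPn/(_ y ys): light2; rewrite -leqNgt.
have neq : uniq [:: x; y].
  by rewrite /= inE andbT; case: eqVneq axy => // ->; rewrite aI.
have sub : {subset [:: x; y] <= s}.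
  by move=> t; rewrite !inE => /orP[] /eqP->.
have [s' ss' [us' s't]] := perm_extract _ _ neq us sub.
have sz := perm_size ss'; rewrite /= in sz.
have nbr t : t \in s' -> [/\ a x y = 2, a x t = 0 & a y t = 0].
  move=> ts'; have ts : t \in s by rewrite (perm_mem ss') mem_cat ts' orbT.
  have xyt : uniq (rcons [:: x; y] t) by rewrite rcons_uniq s't.
  by move: axy (light3 _ _ _ xs ys ts xyt); clear=> ? ?; split; lia.
have xy2 : a x y = 2.
  case: s' sz nbr {ss' us' s't} => [|t s'] /=; first lia.
  by move=> _ /(_ t (mem_head _ _))[].
have pE : psum a s = psum a s' + 4.
  rewrite (perm_psum a _ _ ss') /= !pS !big_cons.
  rewrite big_seq big1 => [|t /nbr[] //]; rewrite big_seq big1 => [|t /nbr[] //].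
  lia.
rewrite pE sz.
have [s'4|s'4] := leqP 4 (size s').
  rewrite -[4]/(2 + 2) !addnA !addn2.
  do 2!(apply: attainable_pendant; first by lia).
  by apply: IHn => //; lia.
case: s' s'4 {ss' s't nbr pE} us' sz => [|u [|v [|t []]]] //= _ us' sz; try lia.
apply: (@attainable_leq _ _ 10); last exact: (attainable_cycle 5).
by have := a3 _ _ _ us'; rewrite !pS p0 !big_cons !big_nil; lia.
Qed.

(** * Sums over pairs *)

(** Each pair is counted once in each order. *)
Lemma pair_sum {V : finType} (F : {set V} -> nat) (X : {set V}) :
  \sum_(x in X) \sum_(y in X | x != y) F [set x; y] =
  (\sum_(e : vpair V | val e \subset X) F (val e)).*2.
Proof.
rewrite -(big_sub_cond (op := addn) [pred e : {set V} | #|e| == 2]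
           [pred e : {set V} | e \subset X] F) /=.
rewrite pair_big_dep /=.
rewrite (partition_big (fun u => [set u.1; u.2])
   (fun e : {set V} => (#|e| == 2) && (e \subset X))) /=; last first.
  case=> x y /= /and3P[xX yX xy]; rewrite cards2 xy.
  by apply/subsetP => z; rewrite !inE => /orP[] /eqP->.
rewrite -muln2 big_distrl /=.
apply: eq_bigr => e /andP[/cards2P[x [y [xy ->]]] sX].
have xX : x \in X by apply: (subsetP sX); rewrite !inE eqxx.
have yX : y \in X by apply: (subsetP sX); rewrite !inE eqxx orbT.
rewrite (bigD1 (x, y)) /=; last by rewrite xX yX xy eqxx.
rewrite (bigD1 (y, x)) /=; last first.
  by rewrite xX yX eq_sym xy setUC eqxx xpair_eqE (eq_sym y) (negPf xy).
rewrite big_pred0 => [|[u v]] /=; first by rewrite [[set y; x]]setUC; lia.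
apply/negP=> /andP[/andP[/andP[/andP[_ /andP[_ uv]] /eqP E] n1] n2].
have : u \in [set x; y] by rewrite -E !inE eqxx.
have : v \in [set x; y] by rewrite -E !inE eqxx orbT.
move: uv n1 n2; rewrite !inE !xpair_eqE => uv n1 n2 /orP[] /eqP vE /orP[] /eqP uE;
  by move: uv n1 n2; rewrite uE vE !eqxx.
Qed.

Lemma pair_sum_seq {V : finType} (F : {set V} -> nat) (s : seq V) :
  uniq s ->
  \sum_(x <- s) \sum_(y <- s | x != y) F [set x; y] =
  (\sum_(e : vpair V | val e \subset [set x in s]) F (val e)).*2.
Proof.
move=> us; rewrite -pair_sum big_uniq //=.
apply: eq_big => [x|x _]; first by rewrite inE.
rewrite -big_filter big_uniq ?filter_uniq //=.
by apply: eq_bigl => y; rewrite mem_filter inE andbC.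
Qed.

Lemma pair_sum4 {V : finType} (F : {set V} -> nat) (x y z t : V) :
  uniq [:: x; y; z; t] ->
  \sum_(e : vpair V | val e \subset [set u in [:: x; y; z; t]]) F (val e) =
  F [set x; y] + F [set x; z] + F [set x; t]
    + F [set y; z] + F [set y; t] + F [set z; t].
Proof.
move=> u4; apply: double_inj; rewrite -pair_sum_seq //.
move: u4; rewrite /= !inE !negb_or -!andbA => /and5P[xy xz xt yz /and3P[yt zt _]].
rewrite !big_cons !big_nil !eqxx /=.
rewrite (eq_sym y x) (eq_sym z x) (eq_sym t x).
rewrite (eq_sym z y) (eq_sym t y) (eq_sym t z).
rewrite xy xz xt yz yt zt (setUC [set y] [set x]) (setUC [set z] [set x]).
rewrite (setUC [set t] [set x]) (setUC [set z] [set y]) (setUC [set t] [set y]).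
by rewrite (setUC [set t] [set z]); lia.
Qed.

(** * Cycles as patterns and the extremal number *)

Lemma cycle_graphP {V : finType} k (E : {set {set V}}) :
  reflect (exists2 f : 'I_k -> V, injective f &
             forall i, [set f i; f (ordS i)] \in E)
          (contains (projT2 (cycle_graph k)) E).
Proof.
apply: (iffP existsP) => [[f /andP[/injectiveP fI /forall_inP fE]]|[f fI fE]].
  exists f => // i; have iC : [set i; ordS i] \in projT2 (cycle_graph k).
    by apply/imsetP; exists i.
  by have := fE _ iC; rewrite imsetU1 imset_set1.
exists (finfun f); apply/andP; split.
  by apply/injectiveP => x y; rewrite !ffunE; apply: fI.
apply/forall_inP => _ /imsetP[i _ ->].
by rewrite imsetU1 imset_set1 !ffunE.
Qed.

Lemma contains_C3 {V : finType} (E : {set {set V}}) :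
  reflect (exists x y z, [/\ uniq [:: x; y; z], [set x; y] \in E,
             [set y; z] \in E & [set z; x] \in E])
          (contains (projT2 (cycle_graph 3)) E).
Proof.
apply: (iffP (cycle_graphP _ _)) => [[f fI fE]|[x [y [z [xyz e1 e2 e3]]]]].
  pose i (k : nat) (lt_k : k < 3) := Ordinal lt_k.
  exists (f (@i 0 isT)), (f (@i 1 isT)), (f (@i 2 isT)).
  split; first by rewrite /= !inE !(inj_eq fI).
  - by move: (fE (@i 0 isT)); rewrite (_ : ordS _ = @i 1 isT) //; apply: val_inj.
  - by move: (fE (@i 1 isT)); rewrite (_ : ordS _ = @i 2 isT) //; apply: val_inj.
  - by move: (fE (@i 2 isT)); rewrite (_ : ordS _ = @i 0 isT) //; apply: val_inj.
exists (fun i : 'I_3 => nth x [:: x; y; z] i).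
  by move=> i j /eqP; rewrite nth_uniq // => /eqP/val_inj.
by case=> [[|[|[]]]].
Qed.

Lemma contains_C4 {V : finType} (E : {set {set V}}) :
  reflect (exists x y z t, [/\ uniq [:: x; y; z; t], [set x; y] \in E,
             [set y; z] \in E, [set z; t] \in E & [set t; x] \in E])
          (contains (projT2 (cycle_graph 4)) E).
Proof.
apply: (iffP (cycle_graphP _ _)) => [[f fI fE]|[x [y [z [t [xyz e1 e2 e3 e4]]]]]].
  pose i (k : nat) (lt_k : k < 4) := Ordinal lt_k.
  exists (f (@i 0 isT)), (f (@i 1 isT)), (f (@i 2 isT)), (f (@i 3 isT)).
  split; first by rewrite /= !inE !(inj_eq fI).
  - by move: (fE (@i 0 isT)); rewrite (_ : ordS _ = @i 1 isT) //; apply: val_inj.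
  - by move: (fE (@i 1 isT)); rewrite (_ : ordS _ = @i 2 isT) //; apply: val_inj.
  - by move: (fE (@i 2 isT)); rewrite (_ : ordS _ = @i 3 isT) //; apply: val_inj.
  - by move: (fE (@i 3 isT)); rewrite (_ : ordS _ = @i 0 isT) //; apply: val_inj.
exists (fun i : 'I_4 => nth x [:: x; y; z; t] i).
  by move=> i j /eqP; rewrite nth_uniq // => /eqP/val_inj.
by case=> [[|[|[|[]]]]].
Qed.

Lemma simple_card {V : finType} (E : {set {set V}}) :
  simple E -> #|E| = \sum_(e : vpair V) (val e \in E).
Proof.
move=> /forall_inP sE; rewrite -sum1_card.
rewrite -(big_sub (op := addn) [pred e : {set V} | #|e| == 2]
           (fun e => e \in E : nat)).
rewrite -big_mkcondr /=; apply: eq_bigl => e; apply/idP/andP => [eE|[] //].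
by split=> //; apply: sE.
Qed.

Lemma attainable_ex n d :
  attainable n d -> d <= (ex n [:: cycle_graph 3; cycle_graph 4]).*2.
Proof.
case=> r [rS rI _ r3 r4] le_d; apply: (leq_trans le_d).
pose E : {set {set 'I_n}} :=
  [set e | [exists i : 'I_n, exists j : 'I_n, (e == [set i; j]) && r i j]].
have inE2 (i j : 'I_n) : ([set i; j] \in E) = r i j.
  rewrite inE; apply/existsP/idP => [[u /existsP[v /andP[/eqP eE uv]]]|ij]; last first.
    by exists i; apply/existsP; exists j; rewrite eqxx.
  have neq : u != v by apply: contraL uv => /eqP->; rewrite rI.
  have ij : i != j.
    by have := cards2 u v; rewrite -eE cards2 neq; case: (i != j).
  have : i \in [set u; v] by rewrite -eE !inE eqxx.
  have : j \in [set u; v] by rewrite -eE !inE eqxx orbT.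
  rewrite !inE; case/orP=> /eqP jE /orP[] /eqP iE; move: ij uv;
    by rewrite iE jE ?eqxx // rS.
have sE : simple E.
  apply/forall_inP => e; rewrite inE => /existsP[u /existsP[v /andP[/eqP-> uv]]].
  by rewrite cards2; case: (eqVneq u v) uv => // ->; rewrite rI.
have -> : \sum_(i < n) \sum_(j < n) r i j = #|E|.*2.
  rewrite simple_card //.
  have := pair_sum (fun e => e \in E : nat) [set: 'I_n].
  under [in RHS]eq_bigl => e do rewrite subsetT.
  move=> <-; apply: eq_big => [i|i _]; first by rewrite inE.
  rewrite [RHS]big_mkcond; apply: eq_bigr => j _; rewrite inE /= inE2.
  by case: eqVneq => // ->; rewrite rI.
rewrite leq_double; apply: (leq_bigmax_cond (P := fun E => _ && _)).
rewrite sE /=; apply/and3P; split=> //.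
  apply/contains_C3 => -[x [y [z [_]]]]; rewrite !inE2 => h1 h2 h3.
  by have := r3 x y z; rewrite h1 h2 h3.
apply/contains_C4 => -[x [y [z [t [u4]]]]]; rewrite !inE2 => h1 h2 h3 h4.
have [xz yt] : x != z /\ y != t.
  by split; apply: contraTneq u4 => ->; rewrite /= !inE !eqxx ?orbT ?andbF.
by have := r4 x y z t xz yt; rewrite h1 h2 h3 h4.
Qed.

Lemma ex_attained n :
  exists E : {set {set 'I_n}},
    [/\ simple E, ~~ contains (projT2 (cycle_graph 3)) E,
        ~~ contains (projT2 (cycle_graph 4)) E
      & #|E| = ex n [:: cycle_graph 3; cycle_graph 4]].
Proof.
pose P (E : {set {set 'I_n}}) := simple E &&
  all (fun H : ograph => ~~ contains (projT2 H) E)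
    [:: cycle_graph 3; cycle_graph 4].
have P0 : P set0.
  apply/and4P; split=> //.
  - by apply/forall_inP => e; rewrite inE.
  - by apply/contains_C3 => -[x [y [z []]]]; rewrite inE.
  - by apply/contains_C4 => -[x [y [z [t []]]]]; rewrite inE.
have [|E PE exE] := @eq_bigmax_cond _ P (fun E => #|E|).
  by apply/card_gt0P; exists set0.
by exists E; case/and4P: PE => ? ? ? _; split.
Qed.

(** * The product of the weights *)

Lemma exists_outside n (s : seq 'I_n) : size s < n -> exists x, x \notin s.
Proof.
move=> s_n; apply/existsP; rewrite -negb_forall; apply: contraL s_n => /forallP sT.
rewrite -leqNgt -[leqLHS]card_ord; apply: leq_trans (card_size s).
by apply/subset_leq_card/subsetP => x _; apply: sT.
Qed.

Lemma edge_product_le n (w : multigraph 'I_n) :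
  4 <= n -> sq_graph 4 9 w ->
  edge_product w <= 2 ^ ex n [:: cycle_graph 3; cycle_graph 4].
Proof.
move=> n4 wP.
have [w_gt0|/forallPn[e]] := boolP [forall e, 0 < w e]; last first.
  by rewrite -eqn0Ngt => /eqP we0; rewrite /edge_product (bigD1 e) //= we0.
move/forallP in w_gt0.
(* [F] extends [w] by 0 to the sets that are not pairs, and [a] is the excess. *)
pose F (e : {set 'I_n}) := oapp w 0 (insub e).
have FE (e : vpair 'I_n) : F (val e) = w e by rewrite /F valK.
pose a x y := (F [set x; y]).-1.
have aS x y : a x y = a y x by rewrite /a setUC.
have aI x : a x x = 0 by rewrite /a /F setUid insubF // cards1.
have a4 x y z t : uniq [:: x; y; z; t] ->
    a x y + a x z + a x t + a y z + a y t + a z t <= 3.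
  move=> u4; have := pair_sum4 F _ _ _ _ u4.
  under eq_bigr => e do rewrite FE.
  have := wP [set u in [:: x; y; z; t]]; rewrite cardsE (card_uniqP u4).
  move=> /(_ erefl) le9 sumE; rewrite {}sumE in le9.
  have F_gt0 u v : u != v -> 0 < F [set u; v].
    move=> uv; have e2 : #|[set u; v]| == 2 by rewrite cards2 uv.
    by rewrite -[[set u; v]](SubK (vpair 'I_n) e2) FE.
  move: u4 le9; rewrite /= !inE !negb_or -!andbA.
  case/and5P=> /F_gt0 + /F_gt0 + /F_gt0 + /F_gt0 + /and3P[/F_gt0 + /F_gt0 + _].
  by rewrite /a; clear; lia.
have a3 x y z : uniq [:: x; y; z] -> a x y + a x z + a y z <= 3.
  move=> u3; have [|t tN] := exists_outside n [:: x; y; z]; first exact: n4.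
  have u4 : uniq (rcons [:: x; y; z] t) by rewrite rcons_uniq tN.
  by have := a4 _ _ _ _ u4; clear; lia.
have le_w e : w e <= 2 ^ (F (val e)).-1.
  by rewrite FE -[leqLHS]prednK ?w_gt0 // ltn_expl.
apply: (@leq_trans (\prod_(e : vpair 'I_n) 2 ^ (F (val e)).-1)).
  by apply: leq_prod.
rewrite -expn_sum leq_exp2l // -leq_double.
have size_enum : size (enum 'I_n) = n by rewrite size_enum_ord.
have := sparse_bound a (enum 'I_n) aS aI a3 a4 (enum_uniq _).
rewrite size_enum => /(_ n4)/attainable_ex; apply: leq_trans.
have := pair_sum_seq (fun e => (F e).-1) (enum 'I_n) (enum_uniq _).
under [in RHS]eq_bigl => e.
  have -> : val e \subset [set x in enum 'I_n].
    by apply/subsetP => x _; rewrite inE mem_enum.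
  over.
move=> <-; apply: leq_sum => x _; rewrite big_mkcond; apply: leq_sum => y _.
by case: ifP.
Qed.

(** In a graph without triangles and 4-cycles, four vertices span a forest. *)
Lemma girth5_four_vertices {V : finType} (E : {set {set V}}) (x y z t : V) :
  ~~ contains (projT2 (cycle_graph 3)) E ->
  ~~ contains (projT2 (cycle_graph 4)) E ->
  uniq [:: x; y; z; t] ->
  ([set x; y] \in E) + ([set x; z] \in E) + ([set x; t] \in E)
    + ([set y; z] \in E) + ([set y; t] \in E) + ([set z; t] \in E) <= 3.
Proof.
move=> /contains_C3 no3 /contains_C4 no4 u4.
have n3 u v s : uniq [:: u; v; s] ->
    ~~ [&& [set u; v] \in E, [set v; s] \in E & [set u; s] \in E].
  move=> us; apply/negP => /and3P[h1 h2 h3]; apply: no3.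
  by exists u, v, s; rewrite (setUC [set s]).
have n4 u v s r : uniq [:: u; v; s; r] ->
    ~~ [&& [set u; v] \in E, [set v; s] \in E, [set s; r] \in E
        & [set u; r] \in E].
  move=> us; apply/negP => /and4P[h1 h2 h3 h4]; apply: no4.
  by exists u, v, s, r; rewrite (setUC [set r] [set u]).
have := n3 _ _ _ (mask_uniq u4 [:: true; true; true; false]).
have := n3 _ _ _ (mask_uniq u4 [:: true; true; false; true]).
have := n3 _ _ _ (mask_uniq u4 [:: true; false; true; true]).
have := n3 _ _ _ (mask_uniq u4 [:: false; true; true; true]).
(* The three 4-cycles on x, y, z, t. *)
have := n4 _ _ _ _ u4.
have [u4' u4''] : uniq [:: x; z; y; t] /\ uniq [:: x; y; t; z].
  by split; apply: etrans u4; apply: perm_uniq; apply/permP => p /=; lia.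
have := n4 _ _ _ _ u4'; have := n4 _ _ _ _ u4''.
rewrite (setUC [set t] [set z]) (setUC [set z] [set y]).
by do 6!case: (_ \in E).
Qed.

Theorem theorem5 (n : nat) (hn : 4 <= n) :
  is_exPi n 4 9 (2 ^ ex n [:: cycle_graph 3; cycle_graph 4]).
Proof.
split; last by move=> w; apply: edge_product_le.
have [E [sE no3 no4 <-]] := ex_attained n.
exists [ffun e => (val e \in E).+1]; last first.
  rewrite simple_card // expn_sum; apply: eq_bigr => e _.
  by rewrite ffunE; case: (_ \in E).
move=> X X4; have := enum_uniq X; have : X = [set x in enum X].
  by apply/setP => x; rewrite inE mem_enum.
have : size (enum X) = 4 by rewrite -cardE.
case: (enum X) => [|x [|y [|z [|t []]]]] //= _ -> u4.
under eq_bigr => e do rewrite ffunE.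
rewrite (pair_sum4 (fun e => (e \in E).+1)) //.
by have := girth5_four_vertices E x y z t no3 no4 u4; do 6!case: (_ \in E).
Qed.
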